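(* Let $q$ be a power of a prime, let $A,A',B,B',C$ be multiplicative characters of $\mathbb{F}_q^*$ and let $x,y\in\mathbb{F}_q$. If $y\neq 0$, then \begin{align*} F_{3}(A,\varepsilon;B,B';C;x,y)&=CB'(-1)\binom{B\overline{C}}{\overline{B'}}\,{}_{2}F_1\left(\begin{matrix}A,B\\ C\end{matrix}\bigg|x\right)-\overline{C}B'(x)\,\delta(y-1)\,B'(-1)\binom{\overline{A}}{\overline{C}B'}\\ &\quad-B'(-1)\,\overline{C}(y)\,\overline{B'}C(1-y)\,{}_{2}F_1\left(\begin{matrix}A,B\\ C\overline{B'}\end{matrix}\bigg|-\frac{x(1-y)}{y}\right)\\ &\quad+(q-1)\,\varepsilon(x)\,C(-1)\,\delta(B\overline{C})\,\overline{A}(1-x); \end{align*} if $x\neq 0$, then \begin{align*} F_{3}(\varepsilon,A';B,B';C;x,y)&=CB(-1)\binom{B'\overline{C}}{\overline{B}}\,{}_{2}F_1\left(\begin{matrix}A',B'\\ C\end{matrix}\bigg|y\right)-\overline{C}B(y)\,\delta(x-1)\,B(-1)\binom{\overline{A'}}{\overline{C}B}\\ &\quad-B(-1)\,\overline{C}(x)\,\overline{B}C(1-x)\,{}_{2}F_1\left(\begin{matrix}A',B'\\ C\overline{B}\end{matrix}\bigg|-\frac{y(1-x)}{x}\right)\\ &\quad+(q-1)\,\varepsilon(y)\,C(-1)\,\delta(B'\overline{C})\,\overline{A'}(1-y). \end{align*}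
   Context: $\mathbb{F}_q$ is the finite field with $q$ elements and $\widehat{\mathbb{F}}_q$ is the group of (complex-valued) multiplicative characters of $\mathbb{F}_q^*$. Every character $\chi$, including the trivial character $\varepsilon$, is extended to $\mathbb{F}_q$ by $\chi(0)=0$. $\overline{\chi}$ is the inverse of $\chi$; juxtaposition of characters is their product, so that e.g. $\overline{C}B'(x)$ means $(\overline{C}B')(x)$ and $CB'(-1)$ means $(CB')(-1)$. For characters $\chi,\lambda$ the Jacobi sum is $J(\chi,\lambda)=\sum_{u\in\mathbb{F}_q}\chi(u)\lambda(1-u)$, and the binomial coefficient of characters $A,B$ is $\binom{A}{B}=B(-1)J(A,\overline{B})$ (no factor $1/q$). For characters $A,B,C$ and $x\in\mathbb{F}_q$, ${}_2F_1\left(\begin{matrix}A,B\\ C\end{matrix}\bigg|x\right)=\varepsilon(x)\,BC(-1)\sum_{y\in\mathbb{F}_q}B(y)\,\overline{B}C(1-y)\,\overline{A}(1-xy)$. The finite field Appell series $F_3$ is $$F_{3}(A,A';B,B';C;x,y)=\varepsilon(xy)\,BB'(-1)\sum_{u,v\in\mathbb{F}_q}B(u)\,B'(v)\,C\overline{B}\,\overline{B'}(1-u-v)\,\overline{A}(1-ux)\,\overline{A'}(1-vy).$$ On characters, $\delta(\chi)=1$ if $\chi=\varepsilon$ and $0$ otherwise; on elements of $\mathbb{F}_q$, $\delta(z)=1$ if $z=0$ and $0$ otherwise. *)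

(* Defs.v *)
From HB Require Import structures.
From mathcomp Require Import all_boot all_order all_algebra all_fingroup.
From mathcomp Require Import all_solvable all_field all_character.

Set Implicit Arguments.
Unset Strict Implicit.
Unset Printing Implicit Defensive.

Import GRing.Theory Num.Theory.
Local Open Scope ring_scope.

(* A multiplicative character of F is chi : mulCF F with chi \is a linear_char.
   Pointwise product, 1 and ^-1 of class functions restrict to the product,
   the trivial character and the inverse of characters.  Complex characters of
   a finite group take values in roots of unity, so algC contains all values. *)
Notation mulCF F := 'CF([set: {unit F}]%G).

Section FiniteFieldHypergeometric.

Variable F : finFieldType.
Implicit Types (A B C chi lambda : mulCF F) (x y z : F).

(* Extension by 0 at 0, also for chi = 1 (the trivial character). *)
Definition ext chi x : algC :=
  if insub x is Some u then chi (u : {unit F}) else 0.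

Definition jacobi_sum chi lambda : algC :=
  \sum_(u : F) ext chi u * ext lambda (1 - u).

(* Unnormalised: no factor 1 / q. *)
Definition binom_char A B : algC := ext B (-1) * jacobi_sum A B^-1.

Definition hyp2F1 A B C x : algC :=
  ext 1 x * ext (B * C) (-1) *
  \sum_(y : F) ext B y * ext (B^-1 * C) (1 - y) * ext A^-1 (1 - x * y).

Definition appellF3 A A' B B' C x y : algC :=
  ext 1 (x * y) * ext (B * B') (-1) *
  \sum_(u : F) \sum_(v : F)
    ext B u * ext B' v * ext (C * B^-1 * B'^-1) (1 - u - v) *
    ext A^-1 (1 - u * x) * ext A'^-1 (1 - v * y).

Definition delta_char chi : algC := (chi == 1)%:R.

Definition delta_elt z : algC := (z == 0)%:R.

End FiniteFieldHypergeometric.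

(* Main.v *)
Require Import Defs.
From mathcomp Require Import all_boot all_order all_algebra all_fingroup.
From mathcomp Require Import all_solvable all_field all_character.
From mathcomp Require Import ring.

Set Implicit Arguments.
Unset Strict Implicit.
Unset Printing Implicit Defensive.

Import GRing.Theory Num.Theory.
Local Open Scope ring_scope.

(** The parameter [A' = 1] contributes to the double sum only the factor
    [ext 1 (1 - v * y)], which is 1 minus the indicator of [v = y^-1].  Hence,
    for [y != 0], the Appell sum is the full double sum without that factor,
    minus its slice at [v = y^-1].

    In the full double sum the inner sum over [v] is a Jacobi sum whose second
    argument has been shifted, [\sum_v B'(v) L(a - v)] with [a = 1 - u] and
    [L = C / (B B')].  By homogeneity ([sum_ext_sub]) it is [(B' L)(a)] times
    the Jacobi sum [J(B', L)], plus a term supported on [a = 0] that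
    orthogonality of characters ([sum_ext]) evaluates: it is non-zero only for
    [B' L = C / B] trivial.  Summing over [u], the homogeneous part is a 2F1
    at [x] and the degenerate part, at [u = 1], is the term with [q - 1].  The
    reflection formula [jacobi_sum_reflect] rewrites [J(B', L)] as the binomial
    coefficient of the statement.

    In the slice [v = y^-1] one has [1 - u - v = t - u], where
    [t = - (1 - y) / y].  If [y != 1], the substitution [u = t w] gives a 2F1
    at [x t].  If [y = 1], then [t = 0], the factors in [u] and [- u] merge,
    and the remaining sum is a Jacobi sum after the scaling [w = u x]; this is
    the term with [delta_elt (y - 1)].  The second formula is the first one
    with the two pairs of parameters exchanged ([appellF3_swap]). *)

(** * Characters extended by zero *)

Section ExtendedCharacters.

Variable F : finFieldType.
Implicit Types (chi lambda : mulCF F) (x y : F).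

Lemma ext_val chi (u : {unit F}) : ext chi (val u) = chi u.
Proof. by rewrite /ext valK. Qed.

Lemma ext0 chi : ext chi 0 = 0.
Proof. by rewrite /ext insubF ?unitr0. Qed.

(** Every non-zero element is the value of a unit, so that an identity between
    extended characters splits into the case 0 and an identity on units. *)
Lemma unit_of_neq0 x : x != 0 -> exists u : {unit F}, x = val u.
Proof. by rewrite -unitfE => ux; exists (Sub x ux); rewrite SubK. Qed.

Lemma ext_charM chi lambda x : ext (chi * lambda) x = ext chi x * ext lambda x.
Proof.
have [->|/unit_of_neq0 [u ->]] := eqVneq x 0; first by rewrite !ext0 mul0r.
by rewrite !ext_val cfunE.
Qed.

Lemma ext_char1 x : ext 1 x = (x != 0)%:R.
Proof.
have [->|/unit_of_neq0 [u ->]] := eqVneq x 0; first by rewrite ext0.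
by rewrite ext_val cfun1E inE.
Qed.

Section LinearCharacter.

Variable chi : mulCF F.
Hypothesis chi_lin : chi \is a linear_char.

Lemma ext_charV x : ext chi^-1 x = (ext chi x)^-1.
Proof.
have [->|/unit_of_neq0 [u ->]] := eqVneq x 0; first by rewrite !ext0 invr0.
rewrite !ext_val; apply: (mulfI (lin_char_neq0 chi_lin (in_setT u))).
rewrite mulfV ?lin_char_neq0 ?inE //.
have /(congr1 (fun phi : mulCF F => phi u)) := mulrV (lin_char_unitr chi_lin).
by rewrite cfunE cfun1E inE.
Qed.

Lemma extM : {morph ext chi : x y / x * y}.
Proof.
move=> x y.
have [->|/unit_of_neq0 [u ->]] := eqVneq x 0; first by rewrite mul0r ext0 mul0r.
have [->|/unit_of_neq0 [v ->]] := eqVneq y 0; first by rewrite mulr0 ext0 mulr0.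
by rewrite -FinRing.val_unitM !ext_val lin_charM ?inE.
Qed.

Lemma ext1 : ext chi 1 = 1.
Proof. by rewrite -FinRing.val_unit1 ext_val lin_char1. Qed.

Lemma ext_neq0 x : x != 0 -> ext chi x != 0.
Proof. by case/unit_of_neq0=> u ->; rewrite ext_val lin_char_neq0 ?inE. Qed.

Lemma extV x : ext chi x^-1 = (ext chi x)^-1.
Proof.
have [->|x0] := eqVneq x 0; first by rewrite invr0 ext0 invr0.
by apply: (mulfI (ext_neq0 x0)); rewrite -extM !mulfV ?ext1 ?ext_neq0.
Qed.

(** Used to settle the sign bookkeeping in the identities below: once each
    [chi(-1)] is replaced by 1 or -1, they are field identities. *)
Lemma extN1_cases : ext chi (-1) = 1 \/ ext chi (-1) = -1.
Proof.
have /eqP : ext chi (-1) ^+ 2 = 1 by rewrite expr2 -extM mulrNN mul1r ext1.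
by rewrite sqrf_eq1 => /orP[] /eqP ->; [left | right].
Qed.

Lemma extN x : ext chi (- x) = ext chi (-1) * ext chi x.
Proof. by rewrite -extM mulN1r. Qed.

(** Orthogonality to the trivial character: translating by a unit [u] leaves
    the sum unchanged but multiplies it by [chi u]. *)
Lemma sum_ext : \sum_(x : F) ext chi x = (#|F|%:R - 1) * delta_char chi.
Proof.
rewrite /delta_char; have [->|chi_neq1] := eqVneq.
  rewrite (bigD1 0) //= ext0 add0r (eq_bigr (fun=> 1)) => [|x x0]; last first.
    by rewrite ext_char1 x0.
  by rewrite sumr_const cardC1 mulr1 -subn1 natrB // (cardD1 0).
(* [delta_char] compares class functions, hence [chi <> 1] is first turned into
   a unit where [chi] differs from 1. *)
have [u chiu] : exists u : {unit F}, chi u != 1.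
  apply/existsP; apply: contra_neqT chi_neq1 => /existsPn chi1.
  by apply/cfunP=> u; rewrite cfun1E inE; apply/eqP; rewrite -[_ == _]negbK.
have u0 : val u != 0 by rewrite -unitfE (valP u).
rewrite mulr0; apply/eqP; have : (chi u - 1) * (\sum_(x : F) ext chi x) == 0.
  rewrite mulrBl mul1r subr_eq0 mulr_sumr; apply/eqP.
  rewrite [RHS](reindex_inj (mulfI u0)) /=.
  by apply: eq_bigr => x _; rewrite extM ext_val.
by rewrite mulf_eq0 subr_eq0 (negPf chiu).
Qed.

End LinearCharacter.

(** * Jacobi sums *)

Lemma jacobi_sumC chi lambda : jacobi_sum chi lambda = jacobi_sum lambda chi.
Proof.
rewrite /jacobi_sum (reindex_inj (can_inj (subKr 1))) /=.
by apply: eq_bigr => u _; rewrite subKr mulrC.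
Qed.

(** After the symmetry [jacobi_sumC], this is the substitution [u = w^-1], a
    bijection of all of [F] because [0^-1 = 0]; for [w != 0] one has
    [1 - w^-1 = - (1 - w) / w]. *)
Lemma jacobi_sum_reflect chi lambda :
    chi \is a linear_char -> lambda \is a linear_char ->
  jacobi_sum chi lambda = ext chi (-1) * jacobi_sum chi (chi * lambda)^-1.
Proof.
move=> chi_lin lambda_lin; have cl_lin := rpredM chi_lin lambda_lin.
rewrite jacobi_sumC [in RHS]jacobi_sumC /jacobi_sum (reindex_inj invr_inj) /=.
rewrite mulr_sumr; apply: eq_bigr => w _; rewrite ext_charV // ext_charM.
have [->|w0] := eqVneq w 0; first by rewrite invr0 !ext0 !(mul0r, mulr0, invr0).
have -> : 1 - w^-1 = - (1 - w) * w^-1 by field.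
rewrite (extM chi_lin) (extN chi_lin) !extV // invfM; ring.
Qed.

(** For [a != 0] the substitution [u = a w] reduces to [a = 1]; for [a = 0] the
    two factors merge into [chi * lambda] and orthogonality applies. *)
Lemma sum_ext_sub chi lambda a :
    chi \is a linear_char -> lambda \is a linear_char ->
  \sum_(u : F) ext chi u * ext lambda (a - u) =
    ext (chi * lambda) a * jacobi_sum chi lambda
    + delta_elt a * ext lambda (-1) * (#|F|%:R - 1)
      * delta_char (chi * lambda).
Proof.
move=> chi_lin lambda_lin; have cl_lin := rpredM chi_lin lambda_lin.
rewrite /delta_elt; have [->|a0] := eqVneq a 0.
  rewrite ext0 mul0r add0r mul1r -mulrA -sum_ext // mulr_sumr.
  by apply: eq_bigr => u _; rewrite sub0r extN // ext_charM mulrCA.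
rewrite !mul0r addr0 (reindex_inj (mulfI a0)) /= mulr_sumr.
apply: eq_bigr => w _; have -> : a - a * w = a * (1 - w) by ring.
by rewrite !extM // ext_charM; ring.
Qed.

End ExtendedCharacters.

(** * The Appell series with a trivial parameter *)

Section AppellF3.

Variable F : finFieldType.
Implicit Types (x y : F).

Lemma appellF3_swap (A A' B B' C : mulCF F) x y :
  appellF3 A A' B B' C x y = appellF3 A' A B' B C y x.
Proof.
rewrite /appellF3 exchange_big (mulrC B) (mulrC x) /=; congr (_ * _).
apply: eq_bigr => v _; apply: eq_bigr => u _.
by rewrite (mulrAC C) (addrAC 1 (- u)); ring.
Qed.

Variables A B B' C : mulCF F.
Hypotheses (A_lin : A \is a linear_char) (B_lin : B \is a linear_char).
Hypotheses (B'_lin : B' \is a linear_char) (C_lin : C \is a linear_char).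

(** The character of [1 - u - v] in the double sum. *)
Let L := C * B^-1 * B'^-1.

Let L_lin : L \is a linear_char.
Proof. by rewrite !rpredM ?rpredV. Qed.

(** With [t = 1 - v] and multiplied by [B'(v)], this is the part at a fixed [v]
    of the double sum without the factor [ext 1 (1 - v * y)]. *)
Let slice x (t : F) :=
  \sum_(u : F) ext B u * ext L (t - u) * ext A^-1 (1 - u * x).

Lemma appellF3_char1_split x y : y != 0 ->
  appellF3 A 1 B B' C x y =
    ext 1 x * ext (B * B') (-1) *
    (\sum_(u : F) ext B u * ext A^-1 (1 - u * x)
       * (\sum_(v : F) ext B' v * ext L (1 - u - v))
     - (ext B' y)^-1 * slice x (1 - y^-1)).
Proof.
move=> y0; rewrite /appellF3 !ext_char1 mulf_eq0 (negPf y0) orbF.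
congr (_ * _); rewrite mulr_sumr -sumrB; apply: eq_bigr => u _.
(* The term [v = y^-1] is 0 on the left and cancels the slice on the right. *)
rewrite (bigD1 y^-1) //= [in RHS](bigD1 y^-1) //= -/L invr1 ext_char1.
rewrite mulVf // subrr eqxx mulr0 add0r extV //.
have -> : 1 - y^-1 - u = 1 - u - y^-1 by ring.
rewrite [in RHS]mulrDr [RHS]addrAC [X in _ = X + _](_ : _ = 0); last by ring.
rewrite add0r mulr_sumr.
apply: eq_bigr => v vNy; rewrite ext_char1 subr_eq0.
have -> : 1 == v * y = false.
  by apply: contraNF vNy => /eqP vy; rewrite -[v](mulfK y0) -vy mul1r.
by rewrite mulr1; ring.
Qed.

Lemma full_sum_char1 x :
  ext 1 x * ext (B * B') (-1) *
  (\sum_(u : F) ext B u * ext A^-1 (1 - u * x)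
     * (\sum_(v : F) ext B' v * ext L (1 - u - v))) =
    ext (C * B') (-1) * binom_char (B * C^-1) B'^-1 * hyp2F1 A B C x
    + (#|F|%:R - 1) * ext 1 x * ext C (-1) * delta_char (B * C^-1)
      * ext A^-1 (1 - x).
Proof.
have B'L : B' * L = B^-1 * C.
  by rewrite /L mulrC mulrVK ?lin_char_unitr // mulrC.
have BL_V : B * C^-1 = (B' * L)^-1.
  by rewrite B'L invrM ?unitrV ?lin_char_unitr // invrK mulrC.
have delta_BL : delta_char (B * C^-1) = delta_char (B' * L).
  by rewrite BL_V /delta_char invr_eq1.
under eq_bigr => u _ do rewrite sum_ext_sub // mulrDr.
rewrite big_split /= mulrDr; congr (_ + _).
  rewrite /binom_char invrK (jacobi_sumC (B * C^-1)) BL_V.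
  rewrite (jacobi_sum_reflect B'_lin L_lin) /hyp2F1.
  (* Generalised so that [mulr_sumr] does not distribute into the Jacobi sum. *)
  rewrite B'L; move: (jacobi_sum _ _) => J.
  rewrite !mulr_sumr; apply: eq_bigr => u _.
  rewrite !ext_charM !ext_charV // (mulrC u).
  by case: (extN1_cases B'_lin) => ->; case: (extN1_cases C_lin) => ->;
    rewrite ?invrN ?invr1; ring.
(* The degenerate part of [sum_ext_sub] lives at [1 - u = 0]. *)
rewrite (bigD1 1) //= [X in _ + X]big1 => [|u u1]; last first.
  by rewrite /delta_elt subr_eq0 eq_sym (negPf u1) !mul0r mulr0.
rewrite /delta_elt subrr eqxx ext1 // !mul1r delta_BL /L !ext_charM !ext_charV //.
by case: (extN1_cases B'_lin) => ->; case: (extN1_cases B_lin) => ->;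
  rewrite ?invrN ?invr1; ring.
Qed.

Lemma slice_neq0 x (t : F) : t != 0 ->
  ext 1 x * slice x t =
    ext (C * B'^-1) t * ext (B * (C * B'^-1)) (-1)
      * hyp2F1 A B (C * B'^-1) (x * t).
Proof.
move=> t0; rewrite /slice (reindex_inj (mulfI t0)) /= /hyp2F1 !mulr_sumr.
apply: eq_bigr => w _; have -> : 1 - t * w * x = 1 - x * t * w by ring.
have -> : t - t * w = t * (1 - w) by ring.
rewrite !ext_char1 mulf_eq0 (negPf t0) orbF !extM // /L !ext_charM !ext_charV //.
have Bt : ext B t != 0 by apply: ext_neq0.
have B't : ext B' t != 0 by apply: ext_neq0.
(* Inverses of possibly vanishing values are generalised: they match on both
   sides, and [field] would otherwise require them to be non-zero. *)
move: (ext B (1 - w))^-1 (ext B' (1 - w))^-1 (ext A _)^-1 => b b' a.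
case: (extN1_cases C_lin) => ->; case: (extN1_cases B_lin) => ->;
  case: (extN1_cases B'_lin) => ->; rewrite ?invrN ?invr1;
  by field; rewrite ?Bt ?B't.
Qed.

(** The factor [ext 1 x] cannot be dropped: at [x = 0] the right-hand side is
    0, whereas [slice 0 0] is a sum of values of [C / B'] up to sign, which is
    non-zero for [C = B']. *)
Lemma slice0 x :
  ext 1 x * slice x 0 =
    ext L (-1) * ext (C^-1 * B') x * jacobi_sum A^-1 (C * B'^-1).
Proof.
have [->|x0] := eqVneq x 0; first by rewrite !ext0 mulr0 !mul0r.
rewrite ext_char1 x0 mul1r jacobi_sumC /jacobi_sum /slice.
rewrite [in RHS](reindex_inj (mulIf x0)) /= mulr_sumr.
apply: eq_bigr => u _; rewrite sub0r extN // /L !ext_charM !ext_charV // !extM //.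
have [->|u0] := eqVneq u 0; first by rewrite !ext0 !(mul0r, mulr0).
have [Bu B'u] : ext B u != 0 /\ ext B' u != 0 by split; apply: ext_neq0.
have [Cx B'x] : ext C x != 0 /\ ext B' x != 0 by split; apply: ext_neq0.
move: (ext A _)^-1 (ext B (-1))^-1 (ext B' (-1))^-1 => a b b'.
by field; rewrite Bu B'u Cx B'x.
Qed.

Lemma appellF3_char1 x y : y != 0 ->
  appellF3 A 1 B B' C x y =
    ext (C * B') (-1) * binom_char (B * C^-1) B'^-1 * hyp2F1 A B C x
    - ext (C^-1 * B') x * delta_elt (y - 1) * ext B' (-1)
      * binom_char A^-1 (C^-1 * B')
    - ext B' (-1) * ext C^-1 y * ext (B'^-1 * C) (1 - y)
      * hyp2F1 A B (C * B'^-1) (- (x * (1 - y) / y))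
    + (#|F|%:R - 1) * ext 1 x * ext C (-1) * delta_char (B * C^-1)
      * ext A^-1 (1 - x).
Proof.
move=> y0; rewrite appellF3_char1_split // mulrBr full_sum_char1.
rewrite [LHS]addrAC; congr (_ + _); rewrite -[RHS]addrA; congr (_ + _).
rewrite -opprD; congr (- _).
have -> : ext 1 x * ext (B * B') (-1) * ((ext B' y)^-1 * slice x (1 - y^-1)) =
    ext (B * B') (-1) * (ext B' y)^-1 * (ext 1 x * slice x (1 - y^-1)) by ring.
rewrite /delta_elt subr_eq0; have [->|y1] := eqVneq y 1 => /=.
  rewrite invr1 subrr slice0 ext0 ext1 // /binom_char.
  have -> : (C^-1 * B')^-1 = C * B'^-1.
    by rewrite invrM ?unitrV ?lin_char_unitr // invrK mulrC.
  rewrite /L !ext_charM !ext_charV //.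
  by case: (extN1_cases C_lin) => ->; case: (extN1_cases B_lin) => ->;
    case: (extN1_cases B'_lin) => ->; rewrite ?invrN ?invr1; ring.
have t0 : 1 - y^-1 != 0 by rewrite subr_eq0 eq_sym invr_eq1.
have -> : - (x * (1 - y) / y) = x * (1 - y^-1) by field.
rewrite slice_neq0 //.
have -> : 1 - y^-1 = - (1 - y) * y^-1 by field.
rewrite !ext_charM !ext_charV // !(extM _ (- (1 - y))) // !(extN _ (1 - y)) //.
rewrite !extV //.
have B'y : ext B' y != 0 by apply: ext_neq0.
rewrite !invfM invrK.
move: (ext B' (1 - y))^-1 (ext C y)^-1 (ext C x)^-1 => b' cy cx.
by case: (extN1_cases C_lin) => ->; case: (extN1_cases B_lin) => ->;
  case: (extN1_cases B'_lin) => ->; rewrite ?invrN ?invr1; field.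
Qed.

End AppellF3.

Theorem theorem3p1 (F : finFieldType) (A A' B B' C : mulCF F)
    (hA : A \is a linear_char) (hA' : A' \is a linear_char)
    (hB : B \is a linear_char) (hB' : B' \is a linear_char)
    (hC : C \is a linear_char) (x y : F) :
  (y != 0 ->
     appellF3 A 1 B B' C x y =
       ext (C * B') (-1) * binom_char (B * C^-1) B'^-1 * hyp2F1 A B C x
       - ext (C^-1 * B') x * delta_elt (y - 1) * ext B' (-1)
         * binom_char A^-1 (C^-1 * B')
       - ext B' (-1) * ext C^-1 y * ext (B'^-1 * C) (1 - y)
         * hyp2F1 A B (C * B'^-1) (- (x * (1 - y) / y))
       + (#|F|%:R - 1) * ext 1 x * ext C (-1) * delta_char (B * C^-1)
         * ext A^-1 (1 - x))
  /\
  (x != 0 ->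
     appellF3 1 A' B B' C x y =
       ext (C * B) (-1) * binom_char (B' * C^-1) B^-1 * hyp2F1 A' B' C y
       - ext (C^-1 * B) y * delta_elt (x - 1) * ext B (-1)
         * binom_char A'^-1 (C^-1 * B)
       - ext B (-1) * ext C^-1 x * ext (B^-1 * C) (1 - x)
         * hyp2F1 A' B' (C * B^-1) (- (y * (1 - x) / x))
       + (#|F|%:R - 1) * ext 1 y * ext C (-1) * delta_char (B' * C^-1)
         * ext A'^-1 (1 - y)).
Proof.
split=> [y0 | x0]; first exact: appellF3_char1.
by rewrite appellF3_swap; apply: appellF3_char1.
Qed.
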